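(* Over $\mathrm{IKP}$, the following are equivalent: (i) $\mathrm{PlUb}$ together with the axiom of Exponentiation; (ii) every set has a powerset.
   Context: $\mathrm{IKP}$ is intuitionistic Kripke–Platek set theory (with strong infinity). Exponentiation asserts that for all sets $a,b$ the set $b^a$ of all functions from $a$ to $b$ exists. An ordinal is a transitive set of transitive sets. For sets $\alpha,\gamma$, $\mathrm{relpl}_\alpha(\gamma)$ denotes $\forall \delta \in \gamma\ \forall \varepsilon \in \alpha\,(\varepsilon \subseteq \delta \rightarrow \varepsilon \in \gamma)$. $\mathrm{PlOrd}$ is the class of ordinals $\alpha$ such that for all $\beta \in \alpha$ and all $\gamma \subseteq \beta$ with $\mathrm{relpl}_\alpha(\gamma)$, we have $\gamma \in \alpha$ and $\forall \delta \in \alpha\,(\beta \in \delta \rightarrow \gamma \in \delta)$. $\mathrm{PlUb}$ is the axiom $\forall \alpha \in \mathrm{PlOrd}\ \exists \beta \in \mathrm{PlOrd}\ \alpha \in \beta$. *)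

(* Defs.v *)
(* Semantic (shallow-with-deep-schemas) rendering of IKP:
   a model is a type M with a membership relation, interpreted in Rocq's
   (intuitionistic) Prop; the axiom schemas of IKP range over a deep
   embedding of first-order formulas of the language {∈, =}. *)
From Stdlib Require Import Arith.
Set Implicit Arguments.

(* First-order formulas with de Bruijn variables. *)
Inductive form : Type :=
| FIn  : nat -> nat -> form
| FEq  : nat -> nat -> form
| FBot : form
| FAnd : form -> form -> form
| FOr  : form -> form -> form
| FImp : form -> form -> form
| FAll : form -> form                (* binds v_0 *)
| FEx  : form -> form.

Inductive Delta0 : form -> Prop :=
| D0In  : forall i j, Delta0 (FIn i j)
| D0Eq  : forall i j, Delta0 (FEq i j)
| D0Bot : Delta0 FBot
| D0And : forall p q, Delta0 p -> Delta0 q -> Delta0 (FAnd p q)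
| D0Or  : forall p q, Delta0 p -> Delta0 q -> Delta0 (FOr p q)
| D0Imp : forall p q, Delta0 p -> Delta0 q -> Delta0 (FImp p q)
| D0BAll : forall k p, k <> 0 -> Delta0 p -> Delta0 (FAll (FImp (FIn 0 k) p))
| D0BEx  : forall k p, k <> 0 -> Delta0 p -> Delta0 (FEx (FAnd (FIn 0 k) p)).

Definition scons {M : Type} (x : M) (e : nat -> M) : nat -> M :=
  fun n => match n with 0 => x | S n' => e n' end.

Fixpoint sat {M : Type} (mem : M -> M -> Prop) (e : nat -> M) (f : form) : Prop :=
  match f with
  | FIn i j => mem (e i) (e j)
  | FEq i j => e i = e j
  | FBot => False
  | FAnd p q => sat mem e p /\ sat mem e q
  | FOr p q => sat mem e p \/ sat mem e q
  | FImp p q => sat mem e p -> sat mem e q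
  | FAll p => forall x, sat mem (scons x e) p
  | FEx p => exists x, sat mem (scons x e) p
  end.

Section SetTheory.
Variables (M : Type) (mem : M -> M -> Prop).

Definition subset (a b : M) : Prop := forall z, mem z a -> mem z b.
Definition is_empty (a : M) : Prop := forall z, ~ mem z a.
Definition is_upair (x y u : M) : Prop := forall z, mem z u <-> (z = x \/ z = y).
Definition is_succ (x s : M) : Prop := forall z, mem z s <-> (mem z x \/ z = x).
Definition inductive (a : M) : Prop :=
  (exists e, is_empty e /\ mem e a) /\
  (forall y, mem y a -> exists s, is_succ y s /\ mem s a).

Record IKP : Prop := {
  ikp_ext : forall a b, (forall z, mem z a <-> mem z b) -> a = b;
  ikp_pair : forall x y, exists u, is_upair x y u;
  ikp_union : forall a, exists u, forall z, mem z u <-> exists y, mem y a /\ mem z y;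
  ikp_strong_inf : exists w, inductive w /\ forall b, inductive b -> subset w b;
  ikp_sep : forall phi, Delta0 phi -> forall (e : nat -> M) a,
      exists b, forall x, mem x b <-> (mem x a /\ sat mem (scons x e) phi);
  ikp_coll : forall phi, Delta0 phi -> forall (e : nat -> M) a,
      (forall x, mem x a -> exists y, sat mem (scons y (scons x e)) phi) ->
      exists b, forall x, mem x a -> exists y, mem y b /\ sat mem (scons y (scons x e)) phi;
  ikp_ind : forall phi (e : nat -> M),
      (forall a, (forall x, mem x a -> sat mem (scons x e) phi) -> sat mem (scons a e) phi) ->
      forall a, sat mem (scons a e) phi
}.

Definition transitive (a : M) : Prop := forall y, mem y a -> subset y a.
Definition is_ordinal (a : M) : Prop := transitive a /\ forall y, mem y a -> transitive y.

Definition relpl (alpha gamma : M) : Prop :=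
  forall delta, mem delta gamma -> forall eps, mem eps alpha ->
    subset eps delta -> mem eps gamma.

Definition PlOrd (alpha : M) : Prop :=
  is_ordinal alpha /\
  forall beta, mem beta alpha -> forall gamma, subset gamma beta -> relpl alpha gamma ->
    mem gamma alpha /\ (forall delta, mem delta alpha -> mem beta delta -> mem gamma delta).

Definition PlUb : Prop := forall alpha, PlOrd alpha -> exists beta, PlOrd beta /\ mem alpha beta.

(* Kuratowski ordered pair p = {{x},{x,y}} *)
Definition is_opair (x y p : M) : Prop :=
  exists u v, is_upair x x u /\ is_upair x y v /\ is_upair u v p.

Definition is_function (f a b : M) : Prop :=
  (forall p, mem p f -> exists x y, mem x a /\ mem y b /\ is_opair x y p) /\
  (forall x, mem x a -> exists y p, mem p f /\ is_opair x y p) /\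
  (forall x y y' p p', mem p f -> mem p' f -> is_opair x y p -> is_opair x y' p' -> y = y').

Definition Exponentiation : Prop :=
  forall a b, exists c, forall f, mem f c <-> is_function f a b.

Definition Powerset : Prop :=
  forall a, exists c, forall x, mem x c <-> subset x a.

End SetTheory.

(* Main.v *)
Require Import Defs.
From Stdlib Require Import Setoid.
Set Implicit Arguments.

(* Powerset gives Exponentiation because the functions from a to b form a
   Δ0-definable subset of P(P(P(a ∪ b))), and it gives PlUb because, for a
   PlOrd α, the subsets γ ⊆ α with relpl_α(γ) form a PlOrd containing α; the
   key fact is that every member of α is itself relpl_α, by ∈-induction.
   Conversely, the second PlOrd above 0 contains every subset of 1 = {0}, i.e.
   every truth value.  A subset x of a is the set of points where its
   characteristic function z ↦ {0 | z ∈ x} is true, so collecting these sets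
   for all functions from a into that PlOrd and keeping those included in a
   yields the powerset of a.  Δ0 separation and collection apply because
   formulas about an ordered pair can bound their quantifiers by the members
   of the members of the pair. *)

(* BAll k p and BEx k p quantify over the members of v_k, with k counted
   outside the new binder. *)
Definition BAll (k : nat) (p : form) : form := FAll (FImp (FIn 0 (S k)) p).
Definition BEx (k : nat) (p : form) : form := FEx (FAnd (FIn 0 (S k)) p).

Definition fsubset (i j : nat) : form := BAll i (FIn 0 (S j)).

Definition fupair (i j k : nat) : form :=
  FAnd (FIn i k) (FAnd (FIn j k) (BAll k (FOr (FEq 0 (S i)) (FEq 0 (S j))))).

Definition fopair (i j k : nat) : form :=
  BEx k (BEx (S k) (FAnd (fupair (S (S i)) (S (S i)) 1)
    (FAnd (fupair (S (S i)) (S (S j)) 0) (fupair 1 0 (S (S k)))))).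

Definition ffunction (i j k : nat) : form :=
  FAnd (BAll i (BEx (S j) (BEx (S (S k)) (fopair 1 0 2))))
  (FAnd (BAll j (BEx (S i) (BEx 0 (BEx 0 (fopair 3 0 2)))))
        (BAll i (BAll (S i) (BAll 1 (BAll 0 (BAll 3 (BAll 0 (BAll 4 (BAll 0
          (FImp (fopair 4 2 7) (FImp (fopair 4 0 6) (FEq 2 0)))))))))))).

Definition frelpl (i j : nat) : form :=
  BAll j (BAll (S i) (FImp (fsubset 0 1) (FIn 0 (S (S j))))).

Definition fvalue_true (i j k : nat) : form :=
  BEx j (BEx 0 (BEx 0 (FAnd (fopair (S (S (S k))) 0 2) (FIn (S (S (S i))) 0)))).

Definition ftrue_set (i j k l : nat) : form :=
  FAnd (BAll l (FAnd (FIn 0 (S k)) (fvalue_true (S i) (S j) 0)))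
       (BAll k (FImp (fvalue_true (S i) (S j) 0) (FIn 0 (S l)))).

Definition fchar_pair (i j k l : nat) : form :=
  BEx l (BEx 0 (FAnd (fopair (S (S k)) 0 (S (S l)))
    (FAnd (BAll 0 (FAnd (FEq 0 (S (S (S i)))) (FIn (S (S (S k))) (S (S (S j))))))
          (FImp (FIn (S (S k)) (S (S j))) (FIn (S (S i)) 0))))).

Lemma Delta0_BAll k p : Delta0 p -> Delta0 (BAll k p).
Proof. now constructor. Qed.

Lemma Delta0_BEx k p : Delta0 p -> Delta0 (BEx k p).
Proof. now constructor. Qed.

Create HintDb delta0.
#[local] Hint Resolve Delta0_BAll Delta0_BEx D0In D0Eq D0And D0Or D0Imp : delta0.

Lemma Delta0_fsubset i j : Delta0 (fsubset i j).
Proof. unfold fsubset; auto with delta0. Qed.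

Lemma Delta0_fupair i j k : Delta0 (fupair i j k).
Proof. unfold fupair; auto with delta0. Qed.
#[local] Hint Resolve Delta0_fsubset Delta0_fupair : delta0.

Lemma Delta0_fopair i j k : Delta0 (fopair i j k).
Proof. unfold fopair; auto with delta0. Qed.
#[local] Hint Resolve Delta0_fopair : delta0.

Lemma Delta0_ffunction i j k : Delta0 (ffunction i j k).
Proof. unfold ffunction; auto 15 with delta0. Qed.

Lemma Delta0_frelpl i j : Delta0 (frelpl i j).
Proof. unfold frelpl; auto with delta0. Qed.
#[local] Hint Resolve Delta0_frelpl : delta0.

Lemma Delta0_fvalue_true i j k : Delta0 (fvalue_true i j k).
Proof. unfold fvalue_true; auto with delta0. Qed.
#[local] Hint Resolve Delta0_fvalue_true : delta0.

Lemma Delta0_ftrue_set i j k l : Delta0 (ftrue_set i j k l).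
Proof. unfold ftrue_set; auto with delta0. Qed.

Lemma Delta0_fchar_pair i j k l : Delta0 (fchar_pair i j k l).
Proof. unfold fchar_pair; auto 10 with delta0. Qed.

Section IKPModel.
Variables (M : Type) (mem : M -> M -> Prop).

Lemma opair_mem_mem x y p w t :
  is_opair mem x y p -> mem w p -> mem t w -> t = x \/ t = y.
Proof.
  intros (u & v & Hu & Hv & Hp) Hw Ht.
  destruct (proj1 (Hp w) Hw) as [-> | ->].
  - left; apply Hu in Ht as [-> | ->]; reflexivity.
  - apply Hv, Ht.
Qed.

Lemma opair_fst_mem_mem x y p : is_opair mem x y p -> exists u, mem u p /\ mem x u.
Proof. intros (u & v & Hu & _ & Hp); exists u; split; [apply Hp | apply Hu]; auto. Qed.

Lemma opair_snd_mem_mem x y p : is_opair mem x y p -> exists v, mem v p /\ mem y v.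
Proof. intros (u & v & _ & Hv & Hp); exists v; split; [apply Hp | apply Hv]; auto. Qed.

Lemma opair_inj x y x' y' p :
  is_opair mem x y p -> is_opair mem x' y' p -> x = x' /\ y = y'.
Proof.
  intros Hxy Hxy'.
  assert (Ex : x = x').
  { destruct Hxy as (u & v & Hu & Hv & Hp), Hxy' as (u' & v' & Hu' & _ & Hp').
    assert (Hu'p : mem u' p) by (apply Hp'; auto).
    apply Hp in Hu'p as [-> | ->].
    - destruct (proj1 (Hu x') (proj2 (Hu' x') (or_introl eq_refl))); auto.
    - destruct (proj1 (Hu' x) (proj2 (Hv x) (or_introl eq_refl))); auto. }
  subst x'; split; [reflexivity|].
  destruct (opair_snd_mem_mem Hxy) as (v & Hv & Hy).
  destruct (opair_snd_mem_mem Hxy') as (v' & Hv' & Hy').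
  destruct (opair_mem_mem Hxy' Hv Hy), (opair_mem_mem Hxy Hv' Hy'); congruence.
Qed.

(* Truth values are the subsets of {e}; the value w of a function is true when e ∈ w. *)
Definition is_truth_value (e : M) (P : Prop) (w : M) : Prop :=
  forall t, mem t w <-> t = e /\ P.

Definition value_true (e f z : M) : Prop :=
  exists w p, mem p f /\ is_opair mem z w p /\ mem e w.

Definition is_true_set (e f a y : M) : Prop :=
  forall z, mem z y <-> mem z a /\ value_true e f z.

Definition char_pair (e x z p : M) : Prop :=
  exists w, is_opair mem z w p /\ is_truth_value e (mem z x) w.

Lemma sat_fupair env i j k :
  sat mem env (fupair i j k) <-> is_upair mem (env i) (env j) (env k).
Proof.
  unfold fupair, BAll, is_upair; cbn [sat scons]; split.
  - intros (Hi & Hj & Hk) z; split; [apply Hk | intros [-> | ->]; assumption].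
  - intros Hu; repeat split; try apply Hu; auto.
Qed.

Lemma sat_fopair env i j k :
  sat mem env (fopair i j k) <-> is_opair mem (env i) (env j) (env k).
Proof.
  unfold fopair, BEx, is_opair; cbn [sat scons].
  setoid_rewrite sat_fupair; cbn [scons]; split.
  - intros (u & _ & v & _ & Hu & Hv & Hp); eauto.
  - intros (u & v & Hu & Hv & Hp).
    exists u; split; [apply Hp; auto|]. exists v; split; [apply Hp; auto|]. auto.
Qed.

Lemma sat_ffunction env i j k :
  sat mem env (ffunction i j k) <-> is_function mem (env i) (env j) (env k).
Proof.
  unfold ffunction, BAll, BEx, is_function; cbn [sat scons].
  setoid_rewrite sat_fopair; cbn [scons].
  split; intros (Hdom & Htot & Huniq); repeat split.
  - intros p Hp; destruct (Hdom p Hp) as (x & Hx & y & Hy & Hxy); eauto.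
  - intros x Hx; destruct (Htot x Hx) as (p & Hp & v & Hv & y & Hy & Hxy); eauto.
  - intros x y y' p p' Hp Hp' Hxy Hxy'.
    destruct (opair_fst_mem_mem Hxy) as (u & Hu & Hx).
    destruct (opair_snd_mem_mem Hxy) as (v & Hv & Hy).
    destruct (opair_snd_mem_mem Hxy') as (v' & Hv' & Hy').
    exact (Huniq p Hp p' Hp' u Hu x Hx v Hv y Hy v' Hv' y' Hy' Hxy Hxy').
  - intros p Hp; destruct (Hdom p Hp) as (x & y & Hx & Hy & Hxy); eauto 6.
  - intros x Hx; destruct (Htot x Hx) as (y & p & Hp & Hxy).
    destruct (opair_snd_mem_mem Hxy) as (v & Hv & Hy); eauto 8.
  - intros p Hp p' Hp' u _ x _ v _ y _ v' _ y' _; apply Huniq; assumption.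
Qed.

Lemma sat_frelpl env i j :
  sat mem env (frelpl i j) <-> relpl mem (env i) (env j).
Proof. reflexivity. Qed.

Lemma sat_fvalue_true env i j k :
  sat mem env (fvalue_true i j k) <-> value_true (env i) (env j) (env k).
Proof.
  unfold fvalue_true, BEx, value_true; cbn [sat scons].
  setoid_rewrite sat_fopair; cbn [scons]; split.
  - intros (p & Hp & v & Hv & w & Hw & Hzw & He); eauto.
  - intros (w & p & Hp & Hzw & He).
    destruct (opair_snd_mem_mem Hzw) as (v & Hv & Hw); eauto 8.
Qed.

Lemma sat_ftrue_set env i j k l :
  sat mem env (ftrue_set i j k l) <-> is_true_set (env i) (env j) (env k) (env l).
Proof.
  unfold ftrue_set, BAll, is_true_set; cbn [sat scons].
  setoid_rewrite sat_fvalue_true; cbn [scons]; split.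
  - intros [Hy Ha] z; split; [apply Hy | intros [Hz Hv]; apply Ha; assumption].
  - intros Hy; split; [intros z; apply Hy | intros z Hz Hv; apply Hy; auto].
Qed.

Lemma sat_fchar_pair env i j k l :
  sat mem env (fchar_pair i j k l) <-> char_pair (env i) (env j) (env k) (env l).
Proof.
  unfold fchar_pair, BAll, BEx, char_pair, is_truth_value; cbn [sat scons].
  setoid_rewrite sat_fopair; cbn [scons]; split.
  - intros (v & _ & w & _ & Hzw & Hw & He).
    exists w; split; [exact Hzw|].
    intros t; split; [exact (Hw t)|].
    intros [-> Hz]; exact (He Hz).
  - intros (w & Hzw & Hw).
    destruct (opair_snd_mem_mem Hzw) as (v & Hv & Hwv).
    exists v; split; [exact Hv|]; exists w; split; [exact Hwv|].
    split; [exact Hzw|]; split.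
    + intros t Ht; apply Hw, Ht.
    + intros Hz; apply Hw; auto.
Qed.

Definition definable (P : M -> Prop) : Prop :=
  exists phi env, Delta0 phi /\ forall x, sat mem (scons x env) phi <-> P x.

Definition definable2 (R : M -> M -> Prop) : Prop :=
  exists phi env, Delta0 phi /\ forall x y, sat mem (scons y (scons x env)) phi <-> R x y.

Lemma definable_relpl alpha : definable (relpl mem alpha).
Proof.
  exists (frelpl 1 0), (fun _ => alpha).
  split; [apply Delta0_frelpl | intros x; apply sat_frelpl].
Qed.

Lemma definable_subset a : definable (fun y => subset mem y a).
Proof.
  exists (fsubset 0 1), (fun _ => a).
  split; [apply Delta0_fsubset | reflexivity].
Qed.

Lemma definable_function a b : definable (fun f => is_function mem f a b).
Proof.
  exists (ffunction 0 1 2), (scons a (fun _ => b)).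
  split; [apply Delta0_ffunction | intros f; apply sat_ffunction].
Qed.

Lemma definable_mem_const z x : definable (fun _ => mem z x).
Proof.
  exists (FIn 1 2), (scons z (fun _ => x)).
  split; [constructor | reflexivity].
Qed.

Lemma definable_value_true e f : definable (value_true e f).
Proof.
  exists (fvalue_true 2 1 0), (scons f (fun _ => e)).
  split; [apply Delta0_fvalue_true | intros z; apply sat_fvalue_true].
Qed.

Lemma definable_char_pair_over e x a :
  definable (fun p => exists z, mem z a /\ char_pair e x z p).
Proof.
  exists (BEx 1 (fchar_pair 3 4 0 1)), (scons a (scons e (fun _ => x))).
  split; [apply Delta0_BEx, Delta0_fchar_pair|].
  intros p; unfold BEx; cbn [sat scons].
  setoid_rewrite sat_fchar_pair; reflexivity.
Qed.

Lemma definable2_char_pair e x : definable2 (char_pair e x).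
Proof.
  exists (fchar_pair 2 3 1 0), (scons e (fun _ => x)).
  split; [apply Delta0_fchar_pair | intros z p; apply sat_fchar_pair].
Qed.

Lemma definable2_true_set e a : definable2 (fun f y => is_true_set e f a y).
Proof.
  exists (ftrue_set 2 1 3 0), (scons e (fun _ => a)).
  split; [apply Delta0_ftrue_set | intros f y; apply sat_ftrue_set].
Qed.

Hypothesis ikp : IKP mem.

Lemma separation P : definable P ->
  forall a, exists b, forall x, mem x b <-> mem x a /\ P x.
Proof.
  intros (phi & env & Hphi & HP) a.
  destruct (ikp_sep ikp Hphi env a) as [b Hb].
  exists b; intros x; rewrite Hb, HP; reflexivity.
Qed.

Lemma collection R : definable2 R ->
  forall a, (forall x, mem x a -> exists y, R x y) ->
  exists b, forall x, mem x a -> exists y, mem y b /\ R x y.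
Proof.
  intros (phi & env & Hphi & HR) a Htot.
  destruct (ikp_coll ikp Hphi env a) as [b Hb].
  - intros x Hx; destruct (Htot x Hx) as [y Hy]; exists y; apply HR, Hy.
  - exists b; intros x Hx; destruct (Hb x Hx) as (y & Hy & Hxy).
    exists y; split; [exact Hy | apply HR, Hxy].
Qed.

Lemma in_induction P : definable P ->
  (forall a, (forall x, mem x a -> P x) -> P a) -> forall a, P a.
Proof.
  intros (phi & env & _ & HP) Hind a.
  apply HP, (ikp_ind ikp phi env).
  intros b Hb; apply HP, Hind; intros x Hx; apply HP, Hb, Hx.
Qed.

Lemma empty_exists : exists e, is_empty mem e.
Proof. destruct (ikp_strong_inf ikp) as (w & ((e & He & _) & _) & _); exists e; exact He. Qed.

Lemma opair_exists x y : exists p, is_opair mem x y p.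
Proof.
  destruct (ikp_pair ikp x x) as [u Hu], (ikp_pair ikp x y) as [v Hv].
  destruct (ikp_pair ikp u v) as [p Hp].
  exists p, u, v; auto.
Qed.

Lemma union2_exists a b : exists u, forall z, mem z u <-> mem z a \/ mem z b.
Proof.
  destruct (ikp_pair ikp a b) as [ab Hab], (ikp_union ikp ab) as [u Hu].
  exists u; intros z; rewrite Hu; split.
  - intros (y & Hy & Hz); apply Hab in Hy as [-> | ->]; auto.
  - intros [Hz | Hz]; [exists a | exists b]; split; try apply Hab; auto.
Qed.

Lemma Exponentiation_of_Powerset : Powerset mem -> Exponentiation mem.
Proof.
  intros pow a b.
  destruct (union2_exists a b) as [U HU].
  destruct (pow U) as [P1 HP1], (pow P1) as [P2 HP2], (pow P2) as [P3 HP3].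
  destruct (separation (definable_function a b) P3) as [c Hc].
  exists c; intros f; rewrite Hc; split; [tauto|].
  intros Hf; split; [|exact Hf].
  apply HP3; intros p Hp; apply HP2; intros w Hw; apply HP1; intros t Ht; apply HU.
  destruct (proj1 Hf p Hp) as (x & y & Hx & Hy & Hxy).
  destruct (opair_mem_mem Hxy Hw Ht) as [-> | ->]; auto.
Qed.

Lemma PlOrd_mem_relpl alpha :
  PlOrd mem alpha -> forall eps, mem eps alpha -> relpl mem alpha eps.
Proof.
  intros [[Htr _] Hpl].
  (* ∈-induction on x; for delta ∈ eps and eps' ⊆ delta, PlOrd at beta := delta
     puts eps' into eps *)
  assert (Hall : forall x eps, mem eps alpha -> subset mem eps x -> relpl mem alpha eps).
  { apply (@in_induction
      (fun x => forall eps, mem eps alpha -> subset mem eps x -> relpl mem alpha eps)).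
    - exists (BAll 1 (FImp (fsubset 0 1) (frelpl 2 0))), (fun _ => alpha).
      split; [auto with delta0 | reflexivity].
    - intros x IH eps Heps Hsub delta Hdelta eps' Heps' Hsub'.
      assert (Hdelta_alpha : mem delta alpha) by exact (Htr eps Heps delta Hdelta).
      pose proof (IH delta (Hsub delta Hdelta) eps' Heps' Hsub') as Hrel'.
      exact (proj2 (Hpl delta Hdelta_alpha eps' Hsub' Hrel') eps Heps Hdelta). }
  intros eps Heps; exact (Hall eps eps Heps (fun z Hz => Hz)).
Qed.

Lemma relpl_subsets_ordinal alpha beta : PlOrd mem alpha ->
  (forall g, mem g beta <-> subset mem g alpha /\ relpl mem alpha g) ->
  is_ordinal mem beta.
Proof.
  intros Ha Hbeta.
  pose proof (PlOrd_mem_relpl Ha) as Hrel.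
  destruct Ha as [[Htr Helt] _]; split.
  - intros y Hy z Hz; apply Hbeta in Hy as [Hya _].
    apply Hbeta; split; [exact (Htr z (Hya z Hz)) | exact (Hrel z (Hya z Hz))].
  - intros y Hy w Hw t Ht; apply Hbeta in Hy as [Hya Hyrel].
    exact (Hyrel w Hw t (Htr w (Hya w Hw) t Ht) (Helt w (Hya w Hw) t Ht)).
Qed.

Lemma relpl_subsets_PlOrd alpha beta : PlOrd mem alpha ->
  (forall g, mem g beta <-> subset mem g alpha /\ relpl mem alpha g) ->
  PlOrd mem beta.
Proof.
  intros Ha Hbeta; split; [exact (relpl_subsets_ordinal Ha Hbeta)|].
  pose proof (PlOrd_mem_relpl Ha) as Hrel.
  destruct Ha as [[Htr _] Hpl].
  intros b Hb g Hgb Hgrel; apply Hbeta in Hb as [Hba _].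
  assert (Hgrel_alpha : relpl mem alpha g).
  { intros d Hd eps Heps Hsub; apply (Hgrel d Hd eps); [|exact Hsub].
    apply Hbeta; split; [exact (Htr eps Heps) | exact (Hrel eps Heps)]. }
  split.
  - apply Hbeta; split; [intros z Hz; exact (Hba z (Hgb z Hz)) | exact Hgrel_alpha].
  - intros d Hd Hbd; apply Hbeta in Hd as [Hda Hdrel].
    destruct (Hpl b (Hda b Hbd) g Hgb Hgrel_alpha) as [Hg_alpha _].
    exact (Hdrel b Hbd g Hg_alpha Hgb).
Qed.

Lemma PlUb_of_Powerset : Powerset mem -> PlUb mem.
Proof.
  intros pow alpha Ha.
  destruct (pow alpha) as [P HP].
  destruct (separation (definable_relpl alpha) P) as [beta Hbeta].
  assert (Hbeta' : forall g, mem g beta <-> subset mem g alpha /\ relpl mem alpha g).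
  { intros g; rewrite Hbeta, HP; reflexivity. }
  exists beta; split; [exact (relpl_subsets_PlOrd Ha Hbeta')|].
  apply Hbeta'; split; [intros z Hz; exact Hz | intros d Hd eps Heps _; exact Heps].
Qed.

Lemma empty_PlOrd e : is_empty mem e -> PlOrd mem e.
Proof. intros He; split; [split|]; intros y Hy; destruct (He y Hy). Qed.

Lemma truth_values_bounded : PlUb mem -> forall e, is_empty mem e ->
  exists omega, forall g, (forall z, mem z g -> z = e) -> mem g omega.
Proof.
  intros plub e He.
  destruct (plub e (empty_PlOrd He)) as (b1 & Hb1 & He_b1).
  destruct (plub b1 Hb1) as (b2 & [_ Hb2] & Hb1_b2).
  exists b2; intros g Hg.
  refine (proj1 (Hb2 b1 Hb1_b2 g _ _)).
  - intros z Hz; rewrite (Hg z Hz); exact He_b1.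
  - intros d Hd eps _ Hsub.
    assert (Hde : d = e) by exact (Hg d Hd); subst d.
    replace eps with e; [exact Hd|].
    apply (ikp_ext ikp); intros z; split; intros Hz.
    + destruct (He z Hz).
    + destruct (He z (Hsub z Hz)).
Qed.

Lemma truth_value_exists e x z : exists w, is_truth_value e (mem z x) w.
Proof.
  destruct (ikp_pair ikp e e) as [s Hs].
  destruct (separation (definable_mem_const z x) s) as [w Hw].
  exists w; intros t; rewrite Hw, (Hs t); tauto.
Qed.

Definition is_char_function (e x a chi : M) : Prop :=
  (forall p, mem p chi -> exists z, mem z a /\ char_pair e x z p) /\
  (forall z, mem z a -> exists p, mem p chi /\ char_pair e x z p).

Lemma char_function_exists e x a : exists chi, is_char_function e x a chi.
Proof.
  assert (Hpairs : forall z, mem z a -> exists p, char_pair e x z p).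
  { intros z _.
    destruct (truth_value_exists e x z) as [w Hw], (opair_exists z w) as [p Hp].
    exists p, w; split; assumption. }
  destruct (collection (definable2_char_pair e x) Hpairs) as [D HD].
  destruct (separation (definable_char_pair_over e x a) D) as [chi Hchi].
  exists chi; split.
  - intros p Hp; apply Hchi in Hp as [_ Hp]; exact Hp.
  - intros z Hz; destruct (HD z Hz) as (p & Hp & Hzp).
    exists p; split; [apply Hchi; eauto | exact Hzp].
Qed.

Lemma char_function_is_function e x a chi omega :
  (forall g, (forall z, mem z g -> z = e) -> mem g omega) ->
  is_char_function e x a chi -> is_function mem chi a omega.
Proof.
  intros Homega [Hgraph Htot]; split; [|split].
  - intros p Hp; destruct (Hgraph p Hp) as (z & Hz & w & Hzw & Hw).
    exists z, w; split; [exact Hz | split; [|exact Hzw]].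
    apply Homega; intros t Ht; apply Hw, Ht.
  - intros z Hz; destruct (Htot z Hz) as (p & Hp & w & Hzw & _).
    exists w, p; split; assumption.
  - intros z w w' p p' Hp Hp' Hzw Hzw'.
    destruct (Hgraph p Hp) as (z1 & _ & w1 & Hzw1 & Hw1).
    destruct (Hgraph p' Hp') as (z2 & _ & w2 & Hzw2 & Hw2).
    destruct (opair_inj Hzw Hzw1) as [<- <-], (opair_inj Hzw' Hzw2) as [<- <-].
    apply (ikp_ext ikp); intros t; rewrite (Hw1 t), (Hw2 t); reflexivity.
Qed.

Lemma char_function_true_set e x a chi :
  subset mem x a -> is_char_function e x a chi -> is_true_set e chi a x.
Proof.
  intros Hxa [Hgraph Htot] z; split.
  - intros Hz; split; [exact (Hxa z Hz)|].
    destruct (Htot z (Hxa z Hz)) as (p & Hp & w & Hzw & Hw).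
    exists w, p; split; [exact Hp | split; [exact Hzw | apply Hw; auto]].
  - intros [_ (w & p & Hp & Hzw & He)].
    destruct (Hgraph p Hp) as (z1 & _ & w1 & Hzw1 & Hw1).
    destruct (opair_inj Hzw Hzw1) as [<- <-].
    apply Hw1 in He as [_ Hz]; exact Hz.
Qed.

Lemma true_sets_collected e a F :
  exists B, forall f, mem f F -> exists y, mem y B /\ is_true_set e f a y.
Proof.
  apply (collection (definable2_true_set e a)).
  intros f _; exact (separation (definable_value_true e f) a).
Qed.

Lemma Powerset_of_PlUb_Exponentiation : PlUb mem -> Exponentiation mem -> Powerset mem.
Proof.
  intros plub exp a.
  destruct empty_exists as [e He].
  destruct (truth_values_bounded plub He) as [omega Homega].
  destruct (exp a omega) as [F HF].
  destruct (true_sets_collected e a F) as [B HB].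
  destruct (separation (definable_subset a) B) as [C HC].
  exists C; intros x; rewrite HC; split; [tauto|].
  intros Hxa.
  destruct (char_function_exists e x a) as [chi Hchi].
  pose proof (proj2 (HF chi) (char_function_is_function Homega Hchi)) as HchiF.
  destruct (HB chi HchiF) as (y & Hy & Hchiy).
  assert (Hyx : y = x).
  { apply (ikp_ext ikp); intros z.
    rewrite (Hchiy z), (char_function_true_set Hxa Hchi z); reflexivity. }
  subst y; split; assumption.
Qed.

End IKPModel.

Theorem lemma3p4 : forall (M : Type) (mem : M -> M -> Prop),
  IKP mem -> ((PlUb mem /\ Exponentiation mem) <-> Powerset mem).
Proof.
  intros M mem ikp; split.
  - intros [plub exp]; exact (Powerset_of_PlUb_Exponentiation ikp plub exp).
  - intros pow; exact (conj (PlUb_of_Powerset ikp pow) (Exponentiation_of_Powerset ikp pow)).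
Qed.
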